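(* Let $f(x_1,\dots,x_n)$ be a homogeneous function on $\mathbb{E}^n$ of degree $d$ (in other words, $f(\lambda x_1,\dots,\lambda x_n)=\lambda^d f(x_1,\dots,x_n)$). Then $$\Gamma\!\left(\frac{n+d}{2}\right)\frac{1}{\sigma(\mathbb{S}^{n-1})}\int_{\mathbb{S}^{n-1}} f\,d\sigma=\Gamma\!\left(\frac n2\right)\mathbb{E}\big(f(\mathbf X_1,\dots,\mathbf X_n)\big),$$ where $\mathbf X_1,\dots,\mathbf X_n$ are independent random variables with probability density $e^{-x^2}/\sqrt{\pi}$.
   Context: $\mathbb{E}^n$ is $n$-dimensional Euclidean space, $\mathbb{S}^{n-1}$ is its unit sphere, and $\sigma$ is the standard area measure on $\mathbb{S}^{n-1}$. $\mathbb{E}(\cdot)$ denotes expectation and $\Gamma$ is the Gamma function. The random variables $\mathbf X_i$ are Gaussian with mean $0$ and variance $1/2$.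
   Formalization: The formal theorem assumes f Borel measurable and n + d > 0; for d ≤ -n the claim fails or is undefined (Γ(0) at d = -n; for n = 1, f = x^(-2) the expectation is infinite). Homogeneity is required only for λ > 0, with d any real number. *)

(* Defs.v *)
From HB Require Import structures.
From mathcomp Require Import all_boot all_order all_algebra.
From mathcomp Require Import all_classical all_reals all_analysis.
From mathcomp Require Import measurable_realfun ring.

Set Implicit Arguments.
Unset Strict Implicit.
Unset Printing Implicit Defensive.

Import Order.TTheory GRing.Theory Num.Theory.
Import numFieldNormedType.Exports.

Local Open Scope classical_set_scope.
Local Open Scope ring_scope.

Definition Gamma (R : realType) (x : R) : R :=
  \int[@lebesgue_measure R]_(t in `]0, +oo[) (t `^ (x - 1) * expR (- t)).

Section euclidean.
Context {R : realType}.

Definition sqnorm n (x : n.-tuple R) : R := \sum_(i < n) tnth x i ^+ 2.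

Definition tscale n (l : R) (x : n.-tuple R) : n.-tuple R :=
  [tuple l * tnth x i | i < n].

Definition unit_sphere n : set (n.-tuple R) := [set x | sqnorm x = 1].

(* Positive homogeneity, of an arbitrary real degree. *)
Definition homogeneous n (d : R) (f : n.-tuple R -> R) : Prop :=
  forall (l : R) (x : n.-tuple R), 0 < l -> f (tscale l x) = l `^ d * f x.

Definition tcons n (p : R * n.-tuple R) : n.+1.-tuple R := [tuple of p.1 :: p.2].

Fixpoint lebesgue_tuple n : set (n.-tuple R) -> \bar R :=
  match n return set (n.-tuple R) -> \bar R with
  | 0 => dirac [tuple]
  | m.+1 => pushforward (@lebesgue_measure R \x @lebesgue_tuple m)%E (@tcons m)
  end.

Lemma measurable_tcons n :
  measurable_fun [set: measurableTypeR R * n.-tuple R] (@tcons n).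
Proof.
apply: (@measurable_cons _ _ (measurableTypeR R * n.-tuple R)%type R fst n snd).
  exact: (@measurable_fst _ _ (measurableTypeR R) (n.-tuple R)).
exact: measurable_snd.
Qed.

Definition tuncons n (x : n.+1.-tuple R) : measurableTypeR R * n.-tuple R :=
  (thead x, [tuple of behead x]).

Lemma tconsK n : cancel (@tcons n) (@tuncons n).
Proof.
move=> [a y]; rewrite /tuncons /tcons /= theadE; congr pair.
exact/val_inj.
Qed.

Lemma measurable_tuncons n : measurable_fun [set: n.+1.-tuple R] (@tuncons n).
Proof.
apply: measurable_fun_pair; last exact: measurable_behead.
exact: (@measurable_tnth _ R n.+1 ord0).
Qed.

End euclidean.
Arguments unit_sphere {R} n.

Section lebesgue_tuple_step.
Context {R : realType} (n : nat).
Variable mu : {sigma_finite_measure set (n.-tuple R) -> \bar R}.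

Let m := pushforward (@lebesgue_measure R \x mu)%E (@tcons R n).

Let m0 : m set0 = 0%E.
Proof. by rewrite /m /pushforward preimage_set0 measure0. Qed.

Let m_ge0 A : (0 <= m A)%E.
Proof. by rewrite /m /pushforward measure_ge0. Qed.

Let m_sigma_additive : semi_sigma_additive m.
Proof.
move=> F mF tF mUF; rewrite /m /pushforward preimage_bigcup.
have mpre A : measurable A -> measurable (@tcons R n @^-1` A).
  by move=> mA; rewrite -[X in measurable X]setTI; exact: measurable_tcons.
apply: measure_semi_sigma_additive.
- by move=> k; exact: mpre.
- apply/trivIsetP => /= i j _ _ ij; rewrite -preimage_setI.
  by move/trivIsetP : tF => /(_ _ _ _ _ ij) ->//; rewrite preimage_set0.
- by rewrite -preimage_bigcup; exact: mpre.
Qed.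

HB.instance Definition _ := isMeasure.Build _ _ _ m m0 m_ge0 m_sigma_additive.

Let m_sigma_finite : sigma_finite setT m.
Proof.
have /sigma_finiteP[F [TF ndF Foo]] := sigma_finiteT (@lebesgue_measure R).
have /sigma_finiteP[G [TG ndG Goo]] := sigma_finiteT mu.
exists (fun k => @tuncons R n @^-1` (F k `*` G k)).
  rewrite -preimage_bigcup; apply/seteqP; split=> // x _ /=.
  have [i _ Fi] : (\bigcup_k F k) (tuncons x).1 by rewrite -TF.
  have [j _ Gj] : (\bigcup_k G k) (tuncons x).2 by rewrite -TG.
  exists (maxn i j) => //; split.
    by move: Fi; exact/subsetPset/ndF/leq_maxl.
  by move: Gj; exact/subsetPset/ndG/leq_maxr.
move=> k; have [mF Fk] := Foo k; have [mG Gk] := Goo k; split.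
  rewrite -[X in measurable X]setTI; apply: measurable_tuncons => //.
  exact: measurableX.
rewrite /m /pushforward -comp_preimage (_ : _ \o _ = id).
  by rewrite preimage_id product_measure1E// lte_mul_pinfty// ge0_fin_numE.
by apply/funext => x /=; exact: tconsK.
Qed.

HB.instance Definition _ := Measure_isSigmaFinite.Build _ _ _ m m_sigma_finite.

Lemma lebesgue_tuple_step :
  exists mu' : {sigma_finite_measure set (n.+1.-tuple R) -> \bar R},
    pushforward (@lebesgue_measure R \x mu)%E (@tcons R n) = mu'.
Proof. by exists m. Qed.

End lebesgue_tuple_step.

Section lebesgue_tuple_measure.
Context {R : realType} (n : nat).

Let lebesgue_tuple_ex :
  exists mu : {sigma_finite_measure set (n.-tuple R) -> \bar R},
    @lebesgue_tuple R n = mu.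
Proof.
elim: n => [|k [mu IH]]; first by exists (dirac ([tuple] : 0.-tuple R)).
by rewrite /= IH; exact: lebesgue_tuple_step.
Qed.

Let lebesgue_tuple0 : @lebesgue_tuple R n set0 = 0%E.
Proof. by have [mu ->] := lebesgue_tuple_ex; exact: measure0. Qed.

Let lebesgue_tuple_ge0 A : (0 <= @lebesgue_tuple R n A)%E.
Proof. by have [mu ->] := lebesgue_tuple_ex; exact: measure_ge0. Qed.

Let lebesgue_tuple_sigma_additive : semi_sigma_additive (@lebesgue_tuple R n).
Proof.
by have [mu ->] := lebesgue_tuple_ex; exact: measure_semi_sigma_additive.
Qed.

HB.instance Definition _ := isMeasure.Build _ _ _ (@lebesgue_tuple R n)
  lebesgue_tuple0 lebesgue_tuple_ge0 lebesgue_tuple_sigma_additive.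

Let lebesgue_tuple_sigma_finite : sigma_finite setT (@lebesgue_tuple R n).
Proof. by have [mu ->] := lebesgue_tuple_ex; exact: sigma_finiteT. Qed.

HB.instance Definition _ := Measure_isSigmaFinite.Build _ _ _
  (@lebesgue_tuple R n) lebesgue_tuple_sigma_finite.

End lebesgue_tuple_measure.

Section area.
Context {R : realType}.

Definition partial_derivative n (g : n.-tuple R -> R) (i : 'I_n)
    (y : n.-tuple R) : R :=
  derive1 (fun t : R => g [tuple if j == i then t else tnth y j | j < n])
    (tnth y i).

(* Area of the part in A of the hypersurface x_0 = g(x_1, ..., x_n) with
   (x_1, ..., x_n) in D: the integral of sqrt (1 + |grad g|^2). *)
Definition graph_area n (D : set (n.-tuple R)) (g : n.-tuple R -> R)
    (A : set (n.+1.-tuple R)) : \bar R :=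
  (\int[@lebesgue_tuple R n]_(y in D `&` [set y | A (tcons (g y, y))])
    (Num.sqrt (1 + \sum_(i < n) partial_derivative g i y ^+ 2))%:E)%E.

Definition unit_ball n : set (n.-tuple R) := [set y | sqnorm y < 1].

(* The unit sphere is the union of the graphs of +- sqrt (1 - |y|^2) over the
   open unit ball (two open hemispheres) and of the equator x_0 = 0, which has
   area zero. For n = 0 the equator is empty, and sphere_area is the counting
   measure of the two points 1 and -1. *)
Definition sphere_area n (A : set (n.+1.-tuple R)) : \bar R :=
  (graph_area (@unit_ball n) (fun y => Num.sqrt (1 - sqnorm y)) A +
   graph_area (@unit_ball n) (fun y => - Num.sqrt (1 - sqnorm y))%R A)%E.

End area.
Arguments sphere_area {R} n A.

Section sphere_area_measure.
Context {R : realType} (n : nat).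

Let measurable_sqnorm : measurable_fun [set: n.-tuple R] (@sqnorm R n).
Proof.
apply: measurable_sum => i; apply: measurable_funX.
exact: (@measurable_tnth _ R n i).
Qed.

Let measurable_unit_ball : measurable (@unit_ball R n).
Proof.
rewrite -[X in measurable X]setTI.
have -> : @unit_ball R n = (@sqnorm R n) @^-1` `]-oo, 1[.
  by apply/seteqP; split=> y /=; rewrite in_itv.
exact: measurable_sqnorm.
Qed.

Let hemi (s : R) (y : n.-tuple R) := s * Num.sqrt (1 - sqnorm y).

Let measurable_hemi s : measurable_fun setT (hemi s).
Proof.
apply: measurable_funM => //.
apply: (@measurableT_comp _ _ _ _ _ _ (@Num.sqrt R)).
  by apply: continuous_measurable_fun; exact: sqrt_continuous.
exact: measurable_funB.
Qed.

Let partial_hemi s i y : unit_ball y ->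
  partial_derivative (hemi s) i y = - s * tnth y i / Num.sqrt (1 - sqnorm y).
Proof.
rewrite /unit_ball /= => y1.
have E t : sqnorm [tuple if j == i then t else tnth y j | j < n] =
    t ^+ 2 + \sum_(j < n | j != i) tnth y j ^+ 2.
  rewrite /sqnorm (bigD1 i)//= tnth_mktuple eqxx; congr +%R.
  by apply: eq_bigr => j ji; rewrite tnth_mktuple (negbTE ji).
set c := \sum_(j < n | j != i) tnth y j ^+ 2 in E.
have Ey : sqnorm y = tnth y i ^+ 2 + c by rewrite /sqnorm (bigD1 i).
rewrite /partial_derivative derive1E.
have -> : (fun t : R => hemi s [tuple if j == i then t else tnth y j | j < n]) =
    (s *: (@Num.sqrt R \o (fun t => 1 - c - t ^+ 2)))%R.
  by apply/funext => t; rewrite /hemi E /= opprD addrA addrAC.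
set t := tnth y i.
have Ec : 1 - c - t ^+ 2 = 1 - sqnorm y by rewrite Ey opprD addrA addrAC.
have t0 : 0 < 1 - c - t ^+ 2 by rewrite Ec subr_gt0.
have d1 : is_derive t 1 (fun t : R => 1 - c - t ^+ 2) (- (2 * t)).
  apply: is_derive_eq; rewrite /GRing.scale /=; ring.
have d2 := @is_derive1_comp R Num.sqrt (fun t => 1 - c - t ^+ 2) t _ _
  (is_derive1_sqrt t0) d1.
have d3 := is_deriveZ s d2.
rewrite derive_val Ec /GRing.scale /=; field.
by rewrite gt_eqF// sqrtr_gt0 subr_gt0.
Qed.

Let density_hemi s y : s ^+ 2 = 1 -> unit_ball y ->
  Num.sqrt (1 + \sum_(i < n) partial_derivative (hemi s) i y ^+ 2) =
  (1 - sqnorm y) `^ (- 2^-1).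
Proof.
move=> s1 By; have y0 : 0 < 1 - sqnorm y by rewrite subr_gt0.
rewrite powRN powR12_sqrt ?ltW// -sqrtrV ?ltW//; congr Num.sqrt.
under eq_bigr do rewrite partial_hemi// !exprMn sqrrN s1 mul1r exprVn.
rewrite -mulr_suml sqr_sqrtr ?ltW// -[X in X + _](divff (lt0r_neq0 y0)).
by rewrite -mulrDl subrK mul1r.
Qed.

Let h (y : n.-tuple R) := ((1 - sqnorm y) `^ (- 2^-1))%:E.

Let graph_areaE s A : s ^+ 2 = 1 ->
  graph_area (@unit_ball R n) (hemi s) A =
  (\int[@lebesgue_tuple R n]_(y in @unit_ball R n `&`
      [set y | A (tcons (hemi s y, y))]) h y)%E.
Proof.
move=> s1; apply: eq_integral => y; rewrite inE => -[By _].
by rewrite density_hemi.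
Qed.

Let measurable_h : measurable_fun setT h.
Proof.
apply/measurable_EFinP.
apply: (@measurableT_comp _ _ _ _ _ _ (fun x : R => x `^ (- 2^-1))).
  exact: measurable_powR.
exact: measurable_funB.
Qed.

Let measurable_chart s A : measurable A ->
  measurable (@unit_ball R n `&` [set y | A (tcons (hemi s y, y))]).
Proof.
move=> mA; apply: measurableI => //.
have m : measurable_fun setT (fun y : n.-tuple R => tcons (hemi s y, y)).
  exact: (@measurable_cons _ _ (n.-tuple R) R (hemi s) n id).
by rewrite -[X in measurable X]setTI; exact: m.
Qed.

Let graph_area_ge0 s A : s ^+ 2 = 1 ->
  (0 <= graph_area (@unit_ball R n) (hemi s) A)%E.
Proof.
move=> s1; rewrite graph_areaE//; apply: integral_ge0 => y _.
by rewrite lee_fin powR_ge0.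
Qed.

Let graph_area_bigcup s F : s ^+ 2 = 1 -> (forall k, measurable (F k)) ->
  trivIset setT F ->
  graph_area (@unit_ball R n) (hemi s) (\bigcup_k F k) =
  (\sum_(k <oo) graph_area (@unit_ball R n) (hemi s) (F k))%E.
Proof.
move=> s1 mF tF; rewrite graph_areaE//.
under eq_eseriesr do rewrite graph_areaE//.
rewrite -ge0_integral_bigcup//.
- by congr integral; rewrite -setI_bigcupr.
- by move=> k; exact: measurable_chart.
- by apply: measurable_funTS; exact: measurable_h.
- by move=> y _; rewrite lee_fin powR_ge0.
- apply/trivIsetP => i j _ _ ij; rewrite setIACA setIid -subset0 => y [_ [Fi Fj]].
  move/trivIsetP : tF => /(_ i j Logic.I Logic.I ij)/seteqP[+ _].
  by move/(_ _ (conj Fi Fj)).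
Qed.

Let sphere_areaE A : @sphere_area R n A =
  (graph_area (@unit_ball R n) (hemi 1) A +
   graph_area (@unit_ball R n) (hemi (-1)) A)%E.
Proof.
have -> : hemi 1 = fun y => Num.sqrt (1 - sqnorm y).
  by apply/funext => y; rewrite /hemi mul1r.
have -> : hemi (-1) = fun y => - Num.sqrt (1 - sqnorm y).
  by apply/funext => y; rewrite /hemi mulN1r.
by [].
Qed.

Let sphere_area0 : @sphere_area R n set0 = 0%E.
Proof.
rewrite /sphere_area /graph_area.
have -> g : [set y : n.-tuple R | set0 (tcons (g y, y))] = set0 by [].
by rewrite !setI0 !integral_set0 adde0.
Qed.

Let sphere_area_ge0 A : (0 <= @sphere_area R n A)%E.
Proof. by rewrite sphere_areaE adde_ge0// graph_area_ge0// ?sqrrN expr1n. Qed.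

Let sphere_area_sigma_additive : semi_sigma_additive (@sphere_area R n).
Proof.
move=> F mF tF mUF.
have -> : sphere_area n (\bigcup_k F k) = (\sum_(k <oo) sphere_area n (F k))%E.
  rewrite sphere_areaE !graph_area_bigcup ?sqrrN ?expr1n//.
  under [RHS]eq_eseriesr do rewrite sphere_areaE.
  rewrite [RHS]nneseriesD// => k _ _; first by rewrite graph_area_ge0// expr1n.
  by rewrite graph_area_ge0// sqrrN expr1n.
exact: is_cvg_ereal_nneg_natsum_cond.
Qed.

HB.instance Definition _ := isMeasure.Build _ _ _ (@sphere_area R n)
  sphere_area0 sphere_area_ge0 sphere_area_sigma_additive.

End sphere_area_measure.

Section random_variables.
Context {R : realType} {d : measure_display} {T : measurableType d}
  {P : probability T R}.

Definition mutually_independent n (X : 'I_n -> {RV P >-> R}) : Prop :=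
  forall (J : {set 'I_n}) (B : 'I_n -> set R),
    (forall i, measurable (B i)) ->
    P (\bigcap_(i in [set i | i \in J]) X i @^-1` B i) =
    (\prod_(i in J) P (X i @^-1` B i))%E.

Definition has_density (X : {RV P >-> R}) (p : R -> R) : Prop :=
  forall B : set R, measurable B ->
    distribution P X B = (\int[lebesgue_measure]_(x in B) (p x)%:E)%E.

End random_variables.

(* Main.v *)
(** Let [w y = (1 - |y|^2)^(-1/2)] be the area density of the hemisphere
    [y |-> (sqrt (1 - |y|^2), y)] over the unit ball. For [f >= 0], write
    [Gamma ((n + 1 + d) / 2)] as the integral of [2 r^(n + d) exp (- r^2)] over
    [r > 0] and multiply it by the integral of [f(sqrt (1 - |y|^2), y) w(y)].
    Homogeneity turns the integrand into
    [2 f(r sqrt (1 - |y|^2), r y) r^n exp (- r^2) w(y)]. Exchanging the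
    integrals and scaling [y = z / r] for fixed [r] gives
    [f(sqrt (r^2 - |z|^2), z) exp (- r^2) 2 r / sqrt (r^2 - |z|^2)], and then
    [x = sqrt (r^2 - |z|^2)] for fixed [z] gives [2 f(x, z) exp (- x^2 - |z|^2)]
    on the half space [x > 0]. Hence the Gamma factor times the integral over
    the sphere is twice the Gaussian integral, with only one-dimensional
    substitutions, all reducible to the squaring map and affine maps. The case
    [f = 1] computes the total area. The general case follows by splitting [f]
    into its positive and negative parts, even when both have infinite
    integral. *)

Require Import Defs.
From HB Require Import structures.
From mathcomp Require Import all_boot all_order all_algebra.
From mathcomp Require Import all_classical all_reals all_analysis.
From mathcomp Require Import measurable_realfun ring.

Set Implicit Arguments.
Unset Strict Implicit.
Unset Printing Implicit Defensive.

Import Order.TTheory GRing.Theory Num.Theory.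
Import numFieldNormedType.Exports.

Local Open Scope classical_set_scope.
Local Open Scope ring_scope.

(** * Image of a measure with density under a measurable map *)

Section pushforward_density.
Local Open Scope ereal_scope.
Context (d1 d2 : measure_display) (T1 : measurableType d1)
  (T2 : measurableType d2) (R : realType).
Variables (mu : {measure set T1 -> \bar R}) (phi : T1 -> T2) (h : T1 -> R).
Hypotheses (mphi : measurable_fun [set: T1] phi)
  (mh : measurable_fun [set: T1] h) (h0 : forall x, (0 <= h x)%R).

(* The proofs are arguments so that the measure structure can be inferred. *)
Definition pushforward_density of measurable_fun [set: T1] phi &
    measurable_fun [set: T1] h & (forall x, (0 <= h x)%R) :=
  fun A : set T2 => \int[mu]_(x in phi @^-1` A) (h x)%:E.

Local Notation m := (pushforward_density mphi mh h0).

Let mpre A : measurable A -> measurable (phi @^-1` A).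
Proof. by move=> mA; rewrite -[X in measurable X]setTI; exact: mphi. Qed.

Let m0 : m set0 = 0.
Proof. by rewrite /pushforward_density preimage_set0 integral_set0. Qed.

Let m_ge0 A : 0 <= m A.
Proof. by apply: integral_ge0 => x _; rewrite lee_fin. Qed.

Let m_sigma_additive : semi_sigma_additive m.
Proof.
move=> F mF tF mUF; rewrite /m preimage_bigcup ge0_integral_bigcup//.
- apply: is_cvg_ereal_nneg_natsum_cond => n _ _.
  by apply: integral_ge0 => x _; rewrite lee_fin.
- by move=> k; exact: mpre.
- exact/measurable_EFinP/measurable_funTS.
- by move=> x _; rewrite lee_fin.
- apply/trivIsetP => /= i j _ _ ij; rewrite -preimage_setI.
  by move/trivIsetP : tF => /(_ _ _ _ _ ij) ->//; rewrite preimage_set0.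
Qed.

HB.instance Definition _ :=
  isMeasure.Build _ _ _ m m0 m_ge0 m_sigma_additive.

Import HBNNSimple.

(** Simple functions approximate [g] from below; monotone convergence on both sides reduces the
    claim to the indicator of one level set, where it is the definition of the image measure. *)
Let ge0_integral_m (g : T2 -> \bar R) :
  measurable_fun [set: T2] g -> (forall x, 0 <= g x) ->
  \int[m]_y g y = \int[mu]_x (g (phi x) * (h x)%:E).
Proof.
move=> mg g0; have meh : measurable_fun setT (EFin \o h) by exact/measurable_EFinP.
pose g_ := nnsfun_approx measurableT mg.
have mgphi n : measurable_fun setT (fun x => (g_ n (phi x))%:E).
  by apply/measurable_EFinP; exact: measurableT_comp.
have -> : \int[m]_x g x = lim (\int[m]_x (EFin \o g_ n) x @[n --> \oo]).
  have gE x : g x = lim ((EFin \o g_ n) x @[n --> \oo]).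
    by apply/esym/cvg_lim => //; exact: cvg_nnsfun_approx.
  under eq_integral do rewrite gE.
  apply: monotone_convergence => //.
  - by move=> n; exact/measurable_EFinP/measurable_funP.
  - by move=> n x _ //=; rewrite lee_fin.
  - by move=> x _ a b ab; rewrite lee_fin; exact/lefP/nd_nnsfun_approx.
have -> : \int[mu]_x (g (phi x) * (h x)%:E) =
    lim (\int[mu]_x ((g_ n (phi x))%:E * (h x)%:E) @[n --> \oo]).
  have gE x : g (phi x) * (h x)%:E =
      lim (((g_ n (phi x))%:E * (h x)%:E) @[n --> \oo]).
    by apply/esym/cvg_lim => //; apply: cvgeZr => //; exact: cvg_nnsfun_approx.
  under eq_integral do rewrite gE.
  apply: monotone_convergence => [//| | |].
  - by move=> n; exact: emeasurable_funM.
  - by move=> n x _ /=; rewrite mule_ge0 ?lee_fin.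
  - move=> x _ a b ab/=; rewrite lee_wpmul2r ?lee_fin//.
    exact/lefP/nd_nnsfun_approx.
congr (limn _); apply/funext => n.
have mi r : measurable_fun setT (fun x => (r * \1_(g_ n @^-1` [set r]) x)%:E).
  by apply/measurable_EFinP; exact: measurable_funM.
under [LHS]eq_integral do rewrite /= fimfunE -fsumEFin//.
rewrite [LHS]ge0_integral_fsum//; last first.
  by move=> r x _; exact: nnfun_muleindic_ge0.
under [RHS]eq_integral => x _.
  rewrite fimfunE -fsumEFin// ge0_mule_fsuml; last first.
    by move=> y; exact: nnfun_muleindic_ge0.
  over.
rewrite [RHS]ge0_integral_fsum//; last 2 first.
  - by move=> r; apply: emeasurable_funM => //; exact: measurableT_comp (mi r) _.
  - move=> r x _; apply: mule_ge0; last by rewrite lee_fin.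
    exact: nnfun_muleindic_ge0.
apply: eq_fsbigr => r; rewrite inE => -[t _ rt].
rewrite integralZl_indic_nnsfun// integral_indic// setIT.
under [RHS]eq_integral do rewrite EFinM -muleA.
rewrite ge0_integralZl//; last 3 first.
  - apply: emeasurable_funM => //; apply/measurable_EFinP.
    exact: measurableT_comp.
  - by move=> x _; rewrite mule_ge0 ?lee_fin.
  - by rewrite -rt lee_fin.
congr (_ * _); rewrite /= /pushforward_density [LHS]integral_mkcond.
by apply: eq_integral => x _; rewrite muleC epatch_indic.
Qed.

(** Stated for any [nu] that agrees with the image measure on measurable sets, so that it also
    applies to measures constructed otherwise, such as Lebesgue measure. *)
Lemma ge0_integral_pushforward_density (nu : {measure set T2 -> \bar R})
    (g : T2 -> \bar R) :
  (forall A, measurable A -> nu A = \int[mu]_(x in phi @^-1` A) (h x)%:E) ->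
  measurable_fun setT g -> (forall y, 0 <= g y) ->
  \int[nu]_y g y = \int[mu]_x (g (phi x) * (h x)%:E).
Proof.
move=> nuE mg g0; rewrite -ge0_integral_m//.
by apply: eq_measure_integral => A mA _; rewrite nuE.
Qed.

End pushforward_density.

(** * One-dimensional substitutions for Lebesgue measure *)

Section change_of_variable.
Local Open Scope ereal_scope.
Context {R : realType}.
Local Notation mu := (@lebesgue_measure R).

(** The image under [s] of the measure with density [h] gives half-open intervals their length, and
    Lebesgue measure is the only measure that does. *)
Lemma lebesgue_change_of_variable (s h : R -> R) (g : R -> \bar R) :
  measurable_fun setT s -> measurable_fun setT h ->
  (forall x, (0 <= h x)%R) ->
  (forall a b, (a <= b)%R ->
    \int[mu]_(x in s @^-1` `]a, b]) (h x)%:E = (b - a)%:E) ->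
  measurable_fun setT g -> (forall y, 0 <= g y) ->
  \int[mu]_y g y = \int[mu]_x (g (s x) * (h x)%:E).
Proof.
move=> ms mh h0 sE mg g0.
pose s' : measurableTypeR R -> measurableTypeR R := s.
apply: (@ge0_integral_pushforward_density _ _ _ _ _ mu s') => //.
move=> A mA; apply: (@lebesgue_measure_unique R
  (@pushforward_density _ _ _ _ _ mu s' h ms mh h0)) => //.
move=> _ [[a b] /= _ <-]; rewrite /pushforward_density.
have [ab|ba] := leP a b; last first.
  rewrite set_itv_ge -?leNgt ?bnd_simp ?(ltW ba)//.
  by rewrite preimage_set0 integral_set0 measure0.
rewrite sE// lebesgue_measure_itv/= lte_fin -EFinB.
by case: ltgtP ab => // -> _; rewrite subrr.
Qed.

Lemma lebesgue_affine (c t : R) (g : R -> \bar R) : (0 < c)%R ->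
  measurable_fun setT g -> (forall y, 0 <= g y) ->
  \int[mu]_y g y = \int[mu]_x (g (c * x + t)%R * c%:E).
Proof.
move=> c0 mg g0.
apply: (@lebesgue_change_of_variable (fun x => c * x + t)%R (cst c)) => //.
- by apply: measurable_funD => //; exact: measurable_funM.
- by move=> x; exact: ltW.
move=> a b ab.
rewrite (_ : _ @^-1` _ = `](a - t) / c, (b - t) / c]%classic)%R; last first.
  apply/seteqP; split => x /=; rewrite !in_itv/=;
    by rewrite ltr_pdivrMr// ler_pdivlMr// ltrBlDr lerBrDr mulrC.
rewrite (eq_integral (cst c%:E))// integral_cst//= lebesgue_measure_itv/=.
rewrite lte_fin -EFinB.
rewrite ltr_pM2r ?invr_gt0// ltrD2r.
case: ltgtP ab => // [ab _|-> _]; last by rewrite mule0 subrr.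
by rewrite -EFinM; congr EFin; field; rewrite gt_eqF.
Qed.

(** The antiderivative [x |x|] is [c x^2] with [c = 1] or [c = -1] on each half line. The
    fundamental theorem is applied to these polynomials, and an interval with 0 in its interior is
    cut there. *)
Lemma integral_2norm (a b : R) : (a <= b)%R ->
  \int[mu]_(x in `]a, b]) (2 * `|x|)%:E = (b * `|b| - a * `|a|)%:E.
Proof.
have ch : continuous (fun x : R => 2 * `|x|)%R.
  move=> x; apply: cvgM; first exact: cvg_cst.
  exact: norm_continuous.
have mh A : measurable_fun A (fun x : R => (2 * `|x|)%:E).
  apply/measurable_EFinP; apply: measurable_funTS.
  exact: continuous_measurable_fun.
have H (c : R) : (c ^+ 2 = 1)%R -> forall u v, (u < v)%R ->
    (forall x, u < x < v -> 0 <= c * x)%R ->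
    \int[mu]_(x in `]u, v]) (2 * `|x|)%:E = (c * v ^+ 2 - c * u ^+ 2)%:E.
  move=> c1 u v uv cx; rewrite integral_itv_obnd_cbnd//.
  have dF (x : R) : is_derive x 1%R (fun x : R => c * x ^+ 2)%R (c * (2 * x))%R.
    by apply: is_derive_eq; rewrite /GRing.scale /=; ring.
  rewrite (@continuous_FTC2 _ _ (fun x => c * x ^+ 2)%R)//.
  - by apply: continuous_subspaceT => x; exact: ch.
  - have cF : continuous (fun x : R => c * x ^+ 2)%R.
      by move=> x; apply/differentiable_continuous/derivable1_diffP; case: (dF x).
    split.
    + by move=> x _; case: (dF x).
    + exact/cvg_at_right_filter/cF.
    + exact/cvg_at_left_filter/cF.
  move=> x; rewrite in_itv/= => /cx x0.
  rewrite derive1E (@derive_val _ _ _ _ _ _ _ (dF x)).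
  have -> : (`|x| = `|c * x|)%R.
    rewrite normrM (_ : `|c| = 1)%R ?mul1r//.
    by apply/eqP; rewrite -sqrp_eq1// real_normK// ?num_real// c1.
  by rewrite ger0_norm//; ring.
rewrite le_eqVlt => /predU1P[->|ab].
  by rewrite set_itvoc0 integral_set0 subrr.
have pos u v : (0 <= u < v)%R -> \int[mu]_(x in `]u, v]) (2 * `|x|)%:E =
    (v * `|v| - u * `|u|)%:E.
  move=> /andP[u0 uv]; have v0 := le_trans u0 (ltW uv).
  rewrite (H 1%R) ?expr1n ?ger0_norm//; first by congr EFin; ring.
  by move=> x /andP[ux _]; rewrite mul1r (le_trans u0)// ltW.
have neg u v : (u < v <= 0)%R -> \int[mu]_(x in `]u, v]) (2 * `|x|)%:E =
    (v * `|v| - u * `|u|)%:E.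
  move=> /andP[uv v0]; have u0 := le_trans (ltW uv) v0.
  rewrite (H (-1)%R) ?sqrrN ?expr1n// ?ler0_norm//; first by congr EFin; ring.
  by move=> x /andP[_ xv]; rewrite mulN1r oppr_ge0 (le_trans (ltW xv)).
have [a0|a0] := leP 0%R a; first by rewrite pos ?a0.
have [b0|b0] := leP b 0%R; first by rewrite neg ?ab.
rewrite (@itv_bndbnd_setU _ _ _ (BRight 0%R)) ?bnd_simp ?ltW//.
rewrite ge0_integral_setU//=.
- rewrite neg ?a0 ?lexx// pos ?b0 ?lexx// -EFinD.
  by rewrite mul0r sub0r subr0 addrC.
- exact: mh.
- apply/disj_setPS => x /=; rewrite !in_itv/= => -[/andP[_ x0] /andP[]].
  by rewrite ltNge x0.
Qed.

(* Pushforward of [2 |x| dx] under [x |-> x |x|], a bijection of the line that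
   extends squaring. *)
Lemma lebesgue_square (g : R -> \bar R) :
  measurable_fun setT g -> (forall y, 0 <= g y) ->
  \int[mu]_(y in `]0%R, +oo[) g y =
  \int[mu]_(x in `]0%R, +oo[) (g (x ^+ 2)%R * (2 * x)%:E).
Proof.
move=> mg g0.
rewrite integral_mkcond [RHS]integral_mkcond.
rewrite (@lebesgue_change_of_variable (fun x => x * `|x|)%R
  (fun x => 2 * `|x|)%R); last 6 first.
- by apply: measurable_funM => //; exact: measurableT_comp.
- by apply: measurable_funM => //; exact: measurableT_comp.
- by move=> x; rewrite mulr_ge0.
(* [r] inverts the increasing bijection [x |x|], so the preimage of []a, b]] is []r a, r b]], to
   which [integral_2norm] gives mass [b - a]. *)
- move=> a b ab; pose r (y : R) : R := (Num.sg y * Num.sqrt `|y|)%R.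
  have rK y : (r y * `|r y| = y)%R.
    rewrite /r normrM normr_sg (ger0_norm (sqrtr_ge0 _)).
    have [->|y0] := eqVneq y 0%R; first by rewrite sgr0 !mul0r.
    by rewrite mul1r -mulrA -expr2 sqr_sqrtr// -numEsg.
  pose s (x : R) : R := (x * `|x|)%R.
  have s_mono : {mono s : x y / (x <= y)%R}.
    apply: le_mono => x y xy; rewrite /s.
    have [x0|x0] := leP 0%R x.
      rewrite !ger0_norm ?(le_trans x0 (ltW xy))//.
      by rewrite -!expr2 ltr_pXn2r// nnegrE (le_trans x0)// ltW.
    rewrite ltr0_norm//; have [y0|y0] := leP 0%R y.
      rewrite ger0_norm// (@lt_le_trans _ _ 0%R) ?mulr_ge0//.
      by rewrite mulrN oppr_lt0 -expr2 exprn_even_gt0//= lt_eqF.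
    rewrite ltr0_norm// !mulrN ltrN2 -!expr2 -sqrrN -[ltRHS]sqrrN.
    by rewrite ltr_pXn2r ?nnegrE ?oppr_ge0 ?ltW// ltrN2.
  rewrite (_ : _ @^-1` _ = `]r a, r b]%classic).
    rewrite integral_2norm ?rK//.
    by rewrite -s_mono /s !rK.
  apply/seteqP; split => x /=; rewrite !in_itv/=.
    by rewrite -{1}(rK a) -{1}(rK b) (leW_mono s_mono) s_mono.
  by rewrite -(leW_mono s_mono) -s_mono /s !rK.
- by apply/(measurable_restrictT _ _).1 => //; exact: measurable_funTS.
- by move=> y; rewrite /patch; case: ifP.
apply: eq_integral => x _; rewrite /patch !mem_setE !in_itv/= !andbT.
have [x0|x0] := ltP 0%R x.
  by rewrite gtr0_norm// mulr_gt0// expr2.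
by rewrite ltNge mulr_le0_ge0// mul0e.
Qed.

End change_of_variable.

(** * Iterated integrals and scaling for Lebesgue measure on tuples *)

Section lebesgue_tuple_integral.
Local Open Scope ereal_scope.
Context {R : realType}.
Local Notation mu := (@lebesgue_measure R).
Local Notation mun n := (@lebesgue_tuple R n).

Lemma measurable_comp_tcons n (g : n.+1.-tuple R -> \bar R) :
  measurable_fun setT g ->
  measurable_fun [set: measurableTypeR R * n.-tuple R] (g \o @tcons R n).
Proof. by move=> mg; exact: measurableT_comp (@measurable_tcons R n). Qed.

(** Lebesgue measure on [n.+1] coordinates is the image of a product measure under [tcons], so
    Tonelli's theorem applies. The first coordinate is integrated last here, and first in the
    swapped version. *)
Lemma ge0_integral_lebesgue_tupleS n (g : n.+1.-tuple R -> \bar R) :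
  measurable_fun setT g -> (forall x, 0 <= g x) ->
  \int[mun n.+1]_x g x = \int[mu]_x \int[mun n]_y g (tcons (x, y)).
Proof.
move=> mg g0.
rewrite (@ge0_integral_pushforward_density _ _ _ _ _
  (mu \x mun n) (@tcons R n) (cst 1%R))//.
- under eq_integral do rewrite mule1.
  apply: (@fubini_tonelli1 _ _ _ _ _ mu (mun n) (g \o @tcons R n)).
    exact: measurable_comp_tcons.
  by move=> p; exact: g0.
- exact: (@measurable_tcons R n).
- move=> A mA; rewrite (eq_integral (cst 1))// integral_cst ?mul1e//.
  by rewrite -[X in measurable X]setTI; exact: (@measurable_tcons R n).
Qed.

Lemma ge0_integral_lebesgue_tupleS_swap n (g : n.+1.-tuple R -> \bar R) :
  measurable_fun setT g -> (forall x, 0 <= g x) ->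
  \int[mun n.+1]_x g x = \int[mun n]_y \int[mu]_x g (tcons (x, y)).
Proof.
move=> mg g0; rewrite ge0_integral_lebesgue_tupleS//.
apply: (@fubini_tonelli _ _ _ _ _ mu (mun n) (g \o @tcons R n)).
  exact: measurable_comp_tcons.
by move=> p; exact: g0.
Qed.

Lemma measurable_tscale n r :
  measurable_fun [set: n.-tuple R] (@tscale R n r).
Proof.
apply/measurable_fun_tnthP => i.
rewrite (_ : _ \o _ = fun x => r * tnth x i)%R.
  by apply: measurable_funM => //; exact: measurable_tnth.
by apply/funext => x /=; rewrite tnth_mktuple.
Qed.

Lemma tscale_tcons n r (p : R * n.-tuple R) :
  tscale r (tcons p) = tcons (r * p.1, tscale r p.2)%R.
Proof.
apply: eq_from_tnth => i; rewrite tnth_mktuple.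
case: (unliftP ord0 i) => [j ->|->]; last by rewrite !tnth0.
by rewrite !tnthS tnth_mktuple.
Qed.

(** By induction on the dimension: the one-dimensional affine substitution scales the head and
    contributes one factor [r], the induction hypothesis scales the tail. *)
Lemma ge0_integral_tscale n r (g : n.-tuple R -> \bar R) : (0 < r)%R ->
  measurable_fun setT g -> (forall x, 0 <= g x) ->
  \int[mun n]_x g x = \int[mun n]_x (g (tscale r x) * (r ^+ n)%:E).
Proof.
move=> r0; elim: n g => [|n IH] g mg g0.
  apply: eq_integral => x _; rewrite expr0 mule1; congr g.
  by apply: eq_from_tnth; case.
have mgr : measurable_fun setT (g \o @tscale R n.+1 r).
  exact: measurableT_comp (measurable_tscale _).
have rn0 : (0 <= r ^+ n)%R by rewrite exprn_ge0// ltW.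
rewrite !ge0_integral_lebesgue_tupleS//; last 2 first.
- exact: emeasurable_funM.
- by move=> x; rewrite mule_ge0// lee_fin exprn_ge0// ltW.
have mgx x : measurable_fun setT (fun y => g (tcons (x, y))).
  exact: (measurableT_comp (measurable_comp_tcons mg) (pair1_measurable x)).
rewrite (@lebesgue_affine R r 0%R)//; last 2 first.
- apply: (@measurable_fun_fubini_tonelli_F _ _ _ _ _ (mun n) (g \o @tcons R n)).
    exact: measurable_comp_tcons.
  by move=> p; exact: g0.
- by move=> x; exact: integral_ge0.
apply: eq_integral => x _; rewrite addr0 IH// -ge0_integralZr//.
- apply: eq_integral => y _; rewrite -muleA -EFinM -exprSr.
  by rewrite tscale_tcons.
- apply: emeasurable_funM => //.
  exact: measurableT_comp (mgx _) (measurable_tscale _).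
- by move=> y _; rewrite mule_ge0// lee_fin.
- by rewrite lee_fin ltW.
Qed.

(** Serves both the Gaussian integral over the whole space and the mass of boxes under a product
    density. *)
Lemma ge0_integral_tuple_prod n (g : 'I_n -> R -> R) :
  (forall i, measurable_fun setT (g i)) -> (forall i x, 0 <= g i x)%R ->
  \int[mun n]_x (\prod_(i < n) g i (tnth x i))%:E =
  \prod_(i < n) \int[mu]_x (g i x)%:E.
Proof.
elim: n g => [|n IH] g mg g0.
  rewrite big_ord0 (eq_integral (cst 1)); last first.
    by move=> x _; rewrite big_ord0.
  by rewrite integral_cst//= diracE in_setT mul1e.
have mprod m (h : 'I_m -> R -> R) : (forall i, measurable_fun setT (h i)) ->
    measurable_fun setT (fun x : m.-tuple R => (\prod_(i < m) h i (tnth x i))%:E).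
  move=> mh; apply/measurable_EFinP; apply: measurable_prod => i _.
  exact: measurableT_comp (mh i) (@measurable_tnth _ R m i).
rewrite ge0_integral_lebesgue_tupleS//; last 2 first.
- exact: mprod.
- by move=> x; rewrite lee_fin prodr_ge0.
have p0 (y : n.-tuple R) : 0 <= (\prod_(i < n) g (lift ord0 i) (tnth y i))%:E.
  by rewrite lee_fin prodr_ge0.
have E x : \int[mun n]_y (\prod_(i < n.+1) g i (tnth (tcons (x, y)) i))%:E =
    (g ord0 x)%:E * \prod_(i < n) \int[mu]_x (g (lift ord0 i) x)%:E.
  rewrite -(IH (fun i => g (lift ord0 i)))// -ge0_integralZl//; last 2 first.
    exact: (@mprod n (fun i => g (lift ord0 i))).
    by rewrite lee_fin.
  apply: eq_integral => y _; rewrite -EFinM big_ord_recl tnth0; congr (_ * _)%:E.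
  by apply: eq_bigr => i _; rewrite tnthS.
under eq_integral do rewrite E.
rewrite ge0_integralZr//.
- by rewrite big_ord_recl.
- by apply/measurable_EFinP; exact: mg.
- by move=> x _; rewrite lee_fin.
- apply: prode_ge0 => i _; apply: integral_ge0 => x _; by rewrite lee_fin.
Qed.

End lebesgue_tuple_integral.

(** * Integration over the sphere through the charts of the two hemispheres *)

Lemma measurable_sqnorm (R : realType) n : measurable_fun [set: n.-tuple R] (@sqnorm R n).
Proof.
apply: measurable_sum => i; apply: measurable_funX.
exact: (@measurable_tnth _ R n i).
Qed.

Lemma measurable_sqrt (R : realType) : measurable_fun [set: R] (@Num.sqrt R).
Proof. by apply: continuous_measurable_fun; exact: sqrt_continuous. Qed.

(** The inverse is the power with exponent -1, which is a measurable function; at 0 both are 0 by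
    convention. *)
Lemma measurable_inv_sqrt (R : realType) (d : measure_display)
    (T : measurableType d) (g : T -> R) :
  measurable_fun setT g -> measurable_fun setT (fun x => (Num.sqrt (g x))^-1).
Proof.
move=> mg; rewrite (_ : (fun _ => _) = fun x => Num.sqrt (g x) `^ (-1)).
  apply: (@measurableT_comp _ _ _ _ _ _ (fun x : R => x `^ (-1))).
    exact: measurable_powR.
  exact: measurableT_comp (@measurable_sqrt R) mg.
by apply/funext => x; rewrite powR_inv1// sqrtr_ge0.
Qed.

Section sphere_integral.
Context {R : realType} (n : nat).
Local Notation mun := (@lebesgue_tuple R n).
Implicit Types y : n.-tuple R.

Lemma sqnorm_ge0 y : 0 <= sqnorm y.
Proof. by apply: sumr_ge0 => i _; exact: sqr_ge0. Qed.

Lemma sqnorm_tcons (x : R) y : sqnorm (tcons (x, y)) = x ^+ 2 + sqnorm y.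
Proof.
rewrite /sqnorm big_ord_recl tnth0; congr +%R.
by apply: eq_bigr => i _; rewrite tnthS.
Qed.

Lemma sqnorm_tscale (r : R) y : sqnorm (tscale r y) = r ^+ 2 * sqnorm y.
Proof.
rewrite /sqnorm mulr_sumr; apply: eq_bigr => i _.
by rewrite tnth_mktuple exprMn.
Qed.

(* Off the open unit ball this is 0^-1 = 0. *)
Definition hemi_density y : R := (Num.sqrt (1 - sqnorm y))^-1.

(** The cases [s = 1] and [s = -1] are the charts of the two open hemispheres over the unit ball;
    the parameter lets them be treated together. *)
Definition hemisphere (s : R) y : n.+1.-tuple R :=
  tcons (s * Num.sqrt (1 - sqnorm y), y).

Lemma hemi_density_ge0 y : 0 <= hemi_density y.
Proof. by rewrite invr_ge0 sqrtr_ge0. Qed.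

Lemma hemi_density_eq0 y : ~ unit_ball y -> hemi_density y = 0.
Proof.
move=> /negP; rewrite /hemi_density -leNgt => y1.
by rewrite ler0_sqrtr ?invr0// subr_le0.
Qed.

Lemma measurable_hemi_density : measurable_fun setT hemi_density.
Proof.
apply: measurable_inv_sqrt.
by apply: measurable_funB => //; exact: measurable_sqnorm.
Qed.

Lemma measurable_hemisphere s : measurable_fun setT (hemisphere s).
Proof.
apply: (@measurable_cons _ _ (n.-tuple R) R _ n id) => //.
apply: measurable_funM => //; apply: measurableT_comp (@measurable_sqrt R) _.
by apply: measurable_funB => //; exact: measurable_sqnorm.
Qed.

Lemma hemisphere_unit s y : s ^+ 2 = 1 -> unit_ball y ->
  unit_sphere n.+1 (hemisphere s y).
Proof.
rewrite /unit_ball /unit_sphere /= => s1 y1.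
by rewrite sqnorm_tcons exprMn s1 mul1r sqr_sqrtr ?subrK// subr_ge0 ltW.
Qed.

Lemma partial_derivative_hemisphere s i y : unit_ball y ->
  partial_derivative (fun z => s * Num.sqrt (1 - sqnorm z)) i y =
  - s * tnth y i * hemi_density y.
Proof.
rewrite /unit_ball /hemi_density /= => y1.
(* [c] gathers the coordinates that stay fixed, which leaves a function of one variable; inside the
   ball the argument of the root is positive, so the chain rule applies. *)
set t := tnth y i; set c := \sum_(j < n | j != i) tnth y j ^+ 2.
have cE u : sqnorm [tuple if j == i then u else tnth y j | j < n] = u ^+ 2 + c.
  rewrite /sqnorm (bigD1 i)//= tnth_mktuple eqxx; congr +%R.
  by apply: eq_bigr => j ji; rewrite tnth_mktuple (negbTE ji).
have Ey : sqnorm y = t ^+ 2 + c by rewrite /sqnorm (bigD1 i).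
have t0 : 0 < 1 - (t ^+ 2 + c) by rewrite -Ey subr_gt0.
rewrite /partial_derivative derive1E; under eq_fun do rewrite cE.
have d1 : is_derive t 1 (fun u : R => 1 - (u ^+ 2 + c)) (- (2 * t)).
  by apply: is_derive_eq; rewrite /GRing.scale /=; ring.
have d2 := is_deriveZ s (@is_derive1_comp R Num.sqrt _ t _ _
  (is_derive1_sqrt t0) d1).
rewrite (@derive_val _ _ _ _ _ _ _ d2) Ey /GRing.scale /=; field.
by rewrite gt_eqF// sqrtr_gt0.
Qed.

Lemma graph_area_hemisphere s A : s ^+ 2 = 1 ->
  graph_area (@unit_ball R n) (fun z => s * Num.sqrt (1 - sqnorm z)) A =
  (\int[mun]_(y in hemisphere s @^-1` A) (hemi_density y)%:E)%E.
Proof.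
move=> s1; rewrite /graph_area integral_mkcond [RHS]integral_mkcond.
apply: eq_integral => y _; rewrite /patch.
have [By|By] := pselect (unit_ball y); last first.
  rewrite hemi_density_eq0// if_same memNset//; by case.
have <- : (y \in hemisphere s @^-1` A) = (y \in (@unit_ball R n) `&`
    [set y | A (tcons (s * Num.sqrt (1 - sqnorm y), y))]).
  by apply/idP/idP; rewrite !inE => //= -[].
case: ifP => // _; congr EFin.
under eq_bigr do rewrite partial_derivative_hemisphere// !exprMn sqrrN s1 mul1r.
have y0 : 0 < 1 - sqnorm y by rewrite subr_gt0.
rewrite -mulr_suml -/(sqnorm y) /hemi_density exprVn sqr_sqrtr ?ltW//.
by rewrite -sqrtrV ?ltW//; congr Num.sqrt; field; rewrite gt_eqF.
Qed.

(** The area measure is the sum of the images of [hemi_density] under the two charts. Both images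
    are carried by the sphere, since the charts map the ball into it and the density vanishes
    elsewhere. *)
Lemma ge0_integral_sphere_area (g : n.+1.-tuple R -> \bar R) :
  measurable_fun setT g -> (forall x, 0 <= g x)%E ->
  (\int[sphere_area n]_(x in unit_sphere n.+1) g x =
   \int[mun]_y (g (hemisphere 1 y) * (hemi_density y)%:E) +
   \int[mun]_y (g (hemisphere (-1) y) * (hemi_density y)%:E))%E.
Proof.
move=> mg g0.
have mS : measurable (@unit_sphere R n.+1).
  rewrite -[X in measurable X]setTI.
  exact: (@measurable_sqnorm R n.+1 _ _ (measurable_set1 1)).
have mgS : measurable_fun setT (g \_ (unit_sphere n.+1)).
  by apply/(measurable_restrictT _ _).1 => //; exact: measurable_funTS.
have gS0 x : (0 <= (g \_ (unit_sphere n.+1)) x)%E.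
  by rewrite /patch; case: ifP.
have ex_nu s : s ^+ 2 = 1 ->
    exists2 nu : {measure set (n.+1.-tuple R) -> \bar R},
    (forall A, nu A =
      graph_area (@unit_ball R n) (fun z => s * Num.sqrt (1 - sqnorm z)) A) &
    (\int[nu]_x (g \_ (unit_sphere n.+1)) x =
      \int[mun]_y (g (hemisphere s y) * (hemi_density y)%:E))%E.
  move=> s1; exists (pushforward_density mun (measurable_hemisphere s)
    measurable_hemi_density hemi_density_ge0).
    by move=> A; rewrite graph_area_hemisphere.
  rewrite (@ge0_integral_pushforward_density _ _ _ _ _ mun
    (hemisphere s) hemi_density)//.
  - apply: eq_integral => y _; rewrite /patch.
    have [By|By] := pselect (unit_ball y); last by rewrite hemi_density_eq0// !mule0.
    by rewrite mem_set//; exact: hemisphere_unit.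
  - exact: measurable_hemisphere.
  - exact: measurable_hemi_density.
  - exact: hemi_density_ge0.
have [|nu1 nu1A nu1I] := ex_nu 1; first by rewrite expr1n.
have [|nu2 nu2A nu2I] := ex_nu (-1); first by rewrite sqrrN expr1n.
rewrite -nu1I -nu2I -ge0_integral_measure_add// integral_mkcond.
apply: eq_measure_integral => A mA _.
rewrite [RHS](measure_addE nu1 nu2) nu1A nu2A.
have E1 : (fun z : n.-tuple R => 1 * Num.sqrt (1 - sqnorm z)) =
    (fun z => Num.sqrt (1 - sqnorm z)).
  by apply/funext => y; rewrite mul1r.
have E2 : (fun z : n.-tuple R => -1 * Num.sqrt (1 - sqnorm z)) =
    (fun z => - Num.sqrt (1 - sqnorm z)).
  by apply/funext => y; rewrite mulN1r.
by rewrite E1 E2.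
Qed.

End sphere_integral.

(** * Tonelli's theorem with one variable restricted to a measurable set *)

Section fubini_tonelli_domain.
Local Open Scope ereal_scope.
Context (d1 d2 : measure_display) (T1 : measurableType d1)
  (T2 : measurableType d2) (R : realType).
Variables (m1 : {sigma_finite_measure set T1 -> \bar R})
  (m2 : {sigma_finite_measure set T2 -> \bar R}).
Variables (D : set T1) (F : T1 * T2 -> \bar R).
Hypotheses (mD : measurable D) (mF : measurable_fun setT F)
  (F0 : forall p, 0 <= F p).

(** The extension of [F] by 0, which reduces the restricted case to the whole product space. *)
Let G := F \_ (D `*` setT).

Let mG : measurable_fun setT G.
Proof.
apply/(measurable_restrictT _ _).1; first exact: measurableX.
exact: measurable_funTS.
Qed.

Let G0 p : 0 <= G p. Proof. by rewrite /G /patch; case: ifP. Qed.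

Let fubini_GE y : fubini_G m1 G y = \int[m1]_(x in D) F (x, y).
Proof.
rewrite /fubini_G [RHS]integral_mkcond.
apply: eq_integral => x _; rewrite /G /patch; congr (if _ then _ else _).
by apply/idP/idP; rewrite !inE; [case|split].
Qed.

Lemma measurable_fun_integral_domain :
  measurable_fun setT (fun y => \int[m1]_(x in D) F (x, y)).
Proof.
under eq_fun do rewrite -fubini_GE.
exact: measurable_fun_fubini_tonelli_G.
Qed.

Lemma fubini_tonelli_domain :
  \int[m1]_(x in D) \int[m2]_y F (x, y) = \int[m2]_y \int[m1]_(x in D) F (x, y).
Proof.
under [RHS]eq_integral do rewrite -fubini_GE.
rewrite -(@fubini_tonelli _ _ _ _ _ m1 m2 G mG G0) integral_mkcond.
apply: eq_integral => x _; rewrite /patch /fubini_F.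
case: ifPn => xD; [|rewrite -[LHS](integral0 m2 setT)];
  apply: eq_integral => y _; rewrite /G /patch.
  by rewrite mem_set//; split => //; exact: set_mem.
by rewrite memNset// => -[/= Dx _]; rewrite mem_set in xD.
Qed.

End fubini_tonelli_domain.

(** * Polar coordinates against the Gaussian weight *)

Section polar.
Local Open Scope ereal_scope.
Context {R : realType}.
Local Notation mu := (@lebesgue_measure R).
Local Notation mun n := (@lebesgue_tuple R n).

(* [Gamma a] is [fine (eGamma a)], which would be 0 if the integral diverged. *)
Definition eGamma (a : R) : \bar R :=
  \int[mu]_(t in `]0%R, +oo[) (t `^ (a - 1) * expR (- t))%:E.

Lemma powR_2nB1 (x a : R) : (0 < x)%R ->
  (x `^ (2 * a - 1) = (x ^+ 2) `^ (a - 1) * x)%R.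
Proof.
move=> x0; rewrite -(powR_mulrn 2 (ltW x0)) -powRrM.
rewrite -[X in _ = (_ * X)%R](powRr1 (ltW x0)) -powRD; last first.
  by apply/implyP => _; rewrite gt_eqF.
by congr (_ `^ _)%R; ring.
Qed.

(** The substitution [t = x^2]. For [a = (n + 1 + d) / 2] the exponent [2 a - 1] is [n + d], the
    power of the radius that polar coordinates produce. *)
Lemma eGamma_square (a : R) : eGamma a =
  \int[mu]_(x in `]0%R, +oo[) (2 * x `^ (2 * a - 1) * expR (- x ^+ 2))%:E.
Proof.
rewrite /eGamma lebesgue_square//.
- apply: eq_integral => x; rewrite inE/= in_itv/= andbT => x0.
  rewrite -EFinM; congr EFin.
  by rewrite powR_2nB1//; ring.
- apply/measurable_EFinP; apply: measurable_funM; first exact: measurable_powR.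
  by apply: measurableT_comp => //; exact: measurable_funN.
- by move=> y; rewrite lee_fin mulr_ge0 ?powR_ge0 ?expR_ge0.
Qed.

(* The substitution [x = sqrt (r^2 - a)]; for [r^2 <= a] the left integrand is 0
   since [0^-1 = 0]. *)
Lemma integral_shell (k : R -> R) (a : R) : (0 <= a)%R ->
  measurable_fun setT k -> (forall x, 0 <= k x)%R ->
  \int[mu]_(r in `]0%R, +oo[) (k (Num.sqrt (r ^+ 2 - a)) * expR (- r ^+ 2) *
      (Num.sqrt (r ^+ 2 - a))^-1 * (2 * r))%:E =
  \int[mu]_(x in `]0%R, +oo[) (2 * (k x * expR (- (x ^+ 2 + a))))%:E.
Proof.
move=> a0 mk k0.
pose G v := (k (Num.sqrt (v - a)) * expR (- v) * (Num.sqrt (v - a))^-1)%:E.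
have msq : measurable_fun setT (fun v : R => Num.sqrt (v - a)).
  apply: measurableT_comp (@measurable_sqrt R) _; exact: measurable_funB.
have mG : measurable_fun setT G.
  apply/measurable_EFinP; apply: measurable_funM; last exact: measurable_inv_sqrt (measurable_funB _ _).
  apply: measurable_funM; first exact: measurableT_comp.
  by apply: measurableT_comp => //; exact: measurable_funN.
have G0 v : 0 <= G v.
  by rewrite lee_fin !mulr_ge0 ?expR_ge0 ?invr_ge0 ?sqrtr_ge0.
have Gle0 v : (v <= a)%R -> G v = 0.
  by move=> va; rewrite /G ler0_sqrtr ?subr_le0// invr0 mulr0.
(* Three substitutions in turn: [v = r^2], [v = u + a], [u = x^2]. As [G] vanishes for [v <= a], the
   half line is widened to the line before the shift and cut back after it. *)
transitivity (\int[mu]_(v in `]0%R, +oo[) G v).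
  by rewrite [RHS]lebesgue_square//; apply: eq_integral => r _; rewrite -EFinM.
transitivity (\int[mu]_v G v).
  rewrite integral_mkcond; apply: eq_integral => v _.
  rewrite /patch mem_setE in_itv/= andbT; case: ltP => // v0.
  by rewrite Gle0// (le_trans v0).
rewrite (@lebesgue_affine R 1%R a)//.
transitivity (\int[mu]_(u in `]0%R, +oo[) G (u + a)%R).
  rewrite [RHS]integral_mkcond; apply: eq_integral => u _.
  rewrite mule1 mul1r /patch mem_setE in_itv/= andbT; case: ltP => // u0.
  by rewrite Gle0// gerDr.
rewrite [LHS]lebesgue_square//; last first.
  by apply: measurableT_comp mG _; exact: measurable_funD.
apply: eq_integral => x; rewrite inE/= in_itv/= andbT => x0.
rewrite -EFinM addrK sqrtr_sqr gtr0_norm//; congr EFin.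
by field; rewrite gt_eqF.
Qed.

Lemma ge0_integral_split0 (K : R -> \bar R) : measurable_fun setT K ->
  (forall x, 0 <= K x) -> \int[mu]_x K x =
  \int[mu]_(x in `]0%R, +oo[) K x + \int[mu]_(x in `]0%R, +oo[) K (- x)%R.
Proof.
move=> mK K0; rewrite addeC integral_itv_obnd_cbnd; last first.
  apply: measurable_funTS; apply: measurableT_comp mK _; exact: measurable_funN.
rewrite (@ge0_integration_by_substitution0 R (fun x => K (- x)%R))//; last first.
  apply: measurableT_comp mK _; exact: measurable_funN.
under [X in X + _]eq_integral do rewrite opprK.
rewrite -ge0_integral_setU//.
- by congr integral; apply/seteqP; split => x //= _; rewrite !in_itv/= andbT;
    case: (leP x 0%R); [left|right].
- exact: measurable_funTS.
- apply/disj_setPS => x /=; rewrite !in_itv/= andbT => -[x0].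
  by rewrite ltNge x0.
Qed.

Section half_space.
Context (n : nat) (d : R) (f : n.+1.-tuple R -> R).
Hypotheses (mf : measurable_fun setT f) (f0 : forall x, (0 <= f x)%R)
  (hf : homogeneous d f).

Lemma measurable_fun_tcons dT (T : measurableType dT) (u : T -> R)
    (v : T -> n.-tuple R) : measurable_fun setT u -> measurable_fun setT v ->
  measurable_fun setT (fun x => f (tcons (u x, v x))).
Proof.
by move=> mu' mv; apply: measurableT_comp mf _; exact: (@measurable_cons _ _ T R u n v).
Qed.

Lemma polar_half_space (s : R) :
  eGamma ((n.+1%:R + d) / 2) *
    \int[mun n]_y ((f (hemisphere s y))%:E * (hemi_density y)%:E) =
  \int[mun n]_z \int[mu]_(x in `]0%R, +oo[)
    (2 * (f (tcons (s * x, z)) * expR (- (x ^+ 2 + sqnorm z))))%:E.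
Proof.
pose F y := (f (hemisphere s y) * hemi_density y)%R.
pose c r : R := (2 * r `^ (n%:R + d) * expR (- r ^+ 2))%R.
(* The integrand in the variables [r] and [z = r y]. The absolute value makes it nonnegative for
   every [r], as Tonelli's theorem asks, and changes nothing for [r > 0]. *)
pose F2 (p : measurableTypeR R * n.-tuple R) : R :=
  (f (tcons (s * Num.sqrt (p.1 ^+ 2 - sqnorm p.2), p.2)) * expR (- p.1 ^+ 2) *
      (Num.sqrt (p.1 ^+ 2 - sqnorm p.2))^-1 * (2 * `|p.1|))%R.
have mF : measurable_fun setT F.
  apply: measurable_funM; last exact: measurable_hemi_density.
  exact: measurableT_comp mf (measurable_hemisphere s).
have F0 y : (0 <= F y)%R by rewrite mulr_ge0// hemi_density_ge0.
have mc : measurable_fun setT c.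
  apply: measurable_funM.
    by apply: measurable_funM => //; exact: measurable_powR.
  apply: measurableT_comp => //; apply: measurable_funN.
  exact: measurable_funX.
have c0 r : (0 <= c r)%R by rewrite !mulr_ge0 ?powR_ge0 ?expR_ge0.
have mF2 : measurable_fun setT F2.
  have m1 : measurable_fun setT (fun p : measurableTypeR R * n.-tuple R => p.1).
    exact: measurable_fst.
  have mq : measurable_fun setT
      (fun p : measurableTypeR R * n.-tuple R => p.1 ^+ 2 - sqnorm p.2)%R.
    apply: measurable_funB; first exact: measurable_funX.
    exact: measurableT_comp (@measurable_sqnorm R n) measurable_snd.
  apply: measurable_funM; last first.
    by apply: measurable_funM => //; exact: measurableT_comp.
  apply: measurable_funM; last exact: measurable_inv_sqrt.
  apply: measurable_funM.
    apply: measurable_fun_tcons; last exact: measurable_snd.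
    apply: measurable_funM => //.
    exact: measurableT_comp (@measurable_sqrt R) mq.
  apply: measurableT_comp => //; apply: measurable_funN.
  exact: measurable_funX.
have F20 p : 0 <= (F2 p)%:E.
  by rewrite lee_fin !mulr_ge0// ?expR_ge0 ?invr_ge0 ?sqrtr_ge0.
transitivity (\int[mun n]_y \int[mu]_(r in `]0%R, +oo[) (c r * F y)%:E).
  rewrite (eq_integral (EFin \o F)); last by move=> y _; rewrite -EFinM.
  rewrite -ge0_integralZl//; last 3 first.
  - exact/measurable_EFinP.
  - by move=> y _; rewrite lee_fin.
  - by apply: integral_ge0 => t _; rewrite lee_fin mulr_ge0 ?powR_ge0 ?expR_ge0.
  apply: eq_integral => y _; rewrite eGamma_square /=.
  have -> : (2 * ((n.+1%:R + d) / 2) - 1 = n%:R + d :> R)%R.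
    have -> : (n.+1%:R = n%:R + 1 :> R)%R by rewrite natr1.
    by field.
  rewrite -ge0_integralZr//; last 3 first.
  - by apply: measurable_funTS; apply/measurable_EFinP; exact: mc.
  - by move=> r _; rewrite lee_fin; exact: c0.
  - by rewrite lee_fin.
rewrite -(@fubini_tonelli_domain _ _ _ _ _ mu (mun n) _
  (fun p => (c p.1 * F p.2)%:E))//; last 2 first.
- apply/measurable_EFinP; apply: measurable_funM.
    exact: measurableT_comp mc measurable_fst.
  exact: measurableT_comp mF measurable_snd.
- by move=> p; rewrite lee_fin mulr_ge0.
(* For fixed [r], the Jacobian [r^n] of [z = r y] and the factor [r^d] from homogeneity make up
   [r^(n + d)]; the [r] in [2 r] cancels the one that leaves the square root. *)
transitivity (\int[mu]_(r in `]0%R, +oo[) \int[mun n]_z (F2 (r, z))%:E).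
  apply: eq_integral => r; rewrite inE/= in_itv/= andbT => r0.
  rewrite [RHS](@ge0_integral_tscale R n r)//; last first.
    apply/measurable_EFinP.
    exact: measurableT_comp mF2 (pair1_measurable r).
  apply: eq_integral => y _; rewrite -EFinM; congr EFin.
  rewrite /c /F /F2 /= sqnorm_tscale.
  have -> : (r ^+ 2 - r ^+ 2 * sqnorm y = r ^+ 2 * (1 - sqnorm y))%R by ring.
  rewrite sqrtrM ?sqr_ge0// sqrtr_sqr gtr0_norm//.
  have -> : tcons (s * (r * Num.sqrt (1 - sqnorm y)), tscale r y)%R =
      tscale r (hemisphere s y).
    by rewrite tscale_tcons /= mulrCA.
  rewrite hf// invfM /hemi_density powRD; last first.
    by apply/implyP => _; rewrite gt_eqF.
  (* The inverse root is generalized to [w] because the root is 0 off the open ball; only [r] then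
     has to be nonzero for [field]. *)
  rewrite powR_mulrn ?ltW//; move: (Num.sqrt (1 - sqnorm y))^-1%R => w.
  by field; rewrite gt_eqF.
have mEF2 : measurable_fun setT (EFin \o F2) by exact/measurable_EFinP.
rewrite [LHS](@fubini_tonelli_domain _ _ _ _ _ mu (mun n) _ _
  (measurable_itv _) mEF2 F20).
apply: eq_integral => z _.
rewrite -(@integral_shell (fun x => f (tcons (s * x, z))%R))//; last 2 first.
- exact: sqnorm_ge0.
- by apply: measurable_fun_tcons => //; exact: measurable_funM.
apply: eq_integral => r; rewrite inE/= in_itv/= andbT => r0.
by rewrite /F2 /= gtr0_norm.
Qed.

(** For [s = 1] and [s = -1], [polar_half_space] gives the integrals over positive and negative
    first coordinates, and [ge0_integral_split0] joins them for each [z]. *)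
Lemma polar_coordinates :
  eGamma ((n.+1%:R + d) / 2) *
    \int[sphere_area n]_(x in unit_sphere n.+1) (f x)%:E =
  \int[mun n.+1]_x (2 * (f x * expR (- sqnorm x)))%:E.
Proof.
pose F x := (2 * (f x * expR (- sqnorm x)))%:E.
have mF : measurable_fun setT F.
  apply/measurable_EFinP; apply: measurable_funM => //; apply: measurable_funM => //.
  apply: measurableT_comp => //; apply: measurable_funN.
  exact: measurable_sqnorm.
have F0 x : 0 <= F x by rewrite lee_fin !mulr_ge0// expR_ge0.
rewrite ge0_integral_sphere_area//; last exact/measurable_EFinP.
rewrite ge0_muleDr; last 2 first.
- by apply: integral_ge0 => y _; rewrite -EFinM lee_fin mulr_ge0// hemi_density_ge0.
- by apply: integral_ge0 => y _; rewrite -EFinM lee_fin mulr_ge0// hemi_density_ge0.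
pose J (s : R) z := \int[mu]_(x in `]0%R, +oo[) F (tcons (s * x, z))%R.
have mJ s : measurable_fun setT (J s).
  apply: (@measurable_fun_integral_domain _ _ _ _ _ mu _
    (fun p : measurableTypeR R * n.-tuple R => F (tcons (s * p.1, p.2))%R)) => //.
  apply: measurableT_comp mF _.
  apply: (@measurable_cons _ _ _ R (fun p => s * p.1)%R n snd).
    by apply: measurable_funM => //; exact: measurable_fst.
  exact: measurable_snd.
have J0 s z : setT z -> 0 <= J s z by move=> _; exact: integral_ge0.
have JE (s : R) : (s ^+ 2 = 1)%R -> eGamma ((n.+1%:R + d) / 2) *
    \int[mun n]_y ((f (hemisphere s y))%:E * (hemi_density y)%:E) =
    \int[mun n]_z J s z.
  move=> s1; rewrite polar_half_space.
  apply: eq_integral => z _; apply: eq_integral => x _.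
  by rewrite /F sqnorm_tcons exprMn s1 mul1r.
transitivity (\int[mun n]_z J 1%R z + \int[mun n]_z J (-1)%R z).
  by congr (_ + _); apply: JE; rewrite ?sqrrN expr1n.
rewrite -(ge0_integralD _ measurableT (J0 _) (mJ _) (J0 _) (mJ _)).
rewrite (ge0_integral_lebesgue_tupleS_swap mF)//; apply: eq_integral => z _.
rewrite [RHS]ge0_integral_split0; last 2 first.
- exact: measurableT_comp (measurable_comp_tcons mF) (pair2_measurable z).
- by move=> x; exact: F0.
apply: (f_equal2 adde); rewrite /J; apply: eq_integral => x _.
  by rewrite mul1r.
by rewrite mulN1r.
Qed.

End half_space.
End polar.

(** * The area of the sphere and the finiteness of the Gamma integral *)

Section gamma_finite.
Local Open Scope ereal_scope.
Context {R : realType}.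
Local Notation mu := (@lebesgue_measure R).

(** An infinite factor would make the product infinite, or 0 if the other factor is 0. Applied to
    the area formula, this shows that the Gamma integral and the area are both finite. *)
Lemma mule_fin_gt0 (x y : \bar R) (c : R) : 0 <= x -> 0 <= y -> (0 < c)%R ->
  x * y = c%:E -> x \is a fin_num /\ y \is a fin_num.
Proof.
move=> x0 y0 c0; case: x x0 => [x| |]//= x0; case: y y0 => [y| |]//= y0.
- rewrite lee_fin le_eqVlt in x0; case/predU1P: x0 => [<-|x0].
    by rewrite mul0e => -[c0']; rewrite -c0' ltxx in c0.
  by rewrite gt0_muley ?lte_fin.
- rewrite lee_fin le_eqVlt in y0; case/predU1P: y0 => [<-|y0].
    by rewrite mule0 => -[c0']; rewrite -c0' ltxx in c0.
  by rewrite gt0_mulye ?lte_fin.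
Qed.

Lemma eGamma_ge0 (a : R) : 0 <= eGamma a.
Proof.
by apply: integral_ge0 => t _; rewrite lee_fin mulr_ge0 ?powR_ge0 ?expR_ge0.
Qed.

Lemma integral_expRN_sqnorm n :
  \int[@lebesgue_tuple R n]_x (expR (- sqnorm x))%:E = (Num.sqrt pi ^+ n)%:E.
Proof.
transitivity (\int[@lebesgue_tuple R n]_x (\prod_(i < n) expR (- tnth x i ^+ 2))%:E).
  by apply: eq_integral => x _; rewrite -expR_sum sumrN.
rewrite (@ge0_integral_tuple_prod R n (fun _ x => expR (- x ^+ 2)))//.
  under eq_bigr do rewrite -[X in integral _ _ X]/(fun x => (gauss_fun x)%:E) integralT_gauss.
  by rewrite prodEFin prodr_const card_ord.
by move=> i; apply: measurableT_comp => //; apply: measurable_funN; exact: measurable_funX.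
Qed.

(** The case [f = 1], [d = 0] of [polar_coordinates]: the classical area formula, kept as a product
    because the finiteness of its factors is deduced from it. *)
Lemma eGamma_sphere_area n :
  eGamma (n.+1%:R / 2 : R) * sphere_area n (unit_sphere n.+1) =
  (2 * Num.sqrt pi ^+ n.+1)%:E.
Proof.
have := @polar_coordinates R n 0%R (cst 1%R) (@measurable_cst _ _ _ _ _ _)
  (fun=> ler01).
rewrite addr0 (eq_integral (cst 1))// integral_cst; last first.
  rewrite -[X in measurable X]setTI.
  exact: (@measurable_sqnorm R n.+1 _ _ (measurable_set1 1%R)).
rewrite mul1e => ->; last by move=> l x l0; rewrite powRr0 mulr1.
under eq_integral do rewrite mul1r EFinM.
rewrite ge0_integralZl_EFin//.
- by rewrite integral_expRN_sqnorm.
- apply/measurable_EFinP; apply: measurableT_comp => //.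
  by apply: measurable_funN; exact: measurable_sqnorm.
Qed.

Lemma eGamma_half_fin n : eGamma (n.+1%:R / 2 : R) \is a fin_num.
Proof.
have := @mule_fin_gt0 _ _ _ (eGamma_ge0 (n.+1%:R / 2))
  (measure_ge0 (sphere_area n) (unit_sphere n.+1)) _ (eGamma_sphere_area n).
by case => //; rewrite mulr_gt0// exprn_gt0// sqrtr_gt0 pi_gt0.
Qed.

(* Substituting [t = x^2] shows that the integral for [a] is twice the one for
   [2 a], so one may assume [1 <= a]. *)
Lemma integral_powR01_lty (k : nat) (a : R) : (1 <= 2 ^+ k * a)%R ->
  \int[mu]_(t in `]0%R, +oo[) (t `^ (a - 1) * \1_`]-oo, 1%R] t)%:E < +oo.
Proof.
have m b : measurable_fun setT (fun t : R => (t `^ (b - 1) * \1_`]-oo, 1%R] t)%:E).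
  apply/measurable_EFinP; apply: measurable_funM; first exact: measurable_powR.
  exact: measurable_indic.
elim: k a => [|k IH] a ka.
  (* Here [1 <= a], so on the positive half line the integrand is at most 1 up to 1 and is 0
     beyond. *)
  rewrite expr0 mul1r in ka.
  apply: (@le_lt_trans _ _ (\int[mu]_(t in `]0%R, +oo[) (\1_`]-oo, 1%R] t)%:E)).
    apply: ge0_le_integral => //.
    - by move=> t _; rewrite lee_fin mulr_ge0// powR_ge0.
    - exact: measurable_funTS (m a).
    - by apply: measurable_funTS; apply/measurable_EFinP; exact: measurable_indic.
    move=> t /=; rewrite in_itv/= andbT lee_fin indicE mem_setE in_itv/= => t0.
    case: (leP t 1%R) => t1; rewrite ?mulr1 ?mulr0//.
    by rewrite -[leRHS](powRr0 t) ger_powR ?t0// subr_ge0.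
  rewrite integral_indic//= (_ : _ `&` _ = `]0%R, 1%R]%classic).
    by rewrite lebesgue_measure_itv/= lte_fin ltr01 -EFinB ltry.
  apply/seteqP; split => t /=; rewrite !in_itv/= andbT.
    by move=> [-> ->].
  by move=> /andP[-> ->].
rewrite lebesgue_square//; last first.
  by move=> t; rewrite lee_fin mulr_ge0// powR_ge0.
rewrite (eq_integral (fun t : measurableTypeR R => 2%:E *
    (t `^ (2 * a - 1) * \1_`]-oo, 1%R] t)%:E)); last first.
  move=> x; rewrite inE/= in_itv/= andbT => x0.
  rewrite -!EFinM powR_2nB1// !indicE !mem_setE !in_itv/= (expr_le1 _ (ltW x0))//.
  by congr EFin; ring.
rewrite ge0_integralZl//=; last 2 first.
- exact: measurable_funTS (m _).
- by move=> t _; rewrite lee_fin mulr_ge0// powR_ge0.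
by rewrite lte_mul_pinfty// IH// mulrA -exprSr.
Qed.

(** The integrand is dominated by [t^(a - 1)] up to 1, and beyond 1 by the integrand of a
    half-integer argument above [a], whose integral is finite by the area formula. *)
Lemma eGamma_fin (a : R) : (0 < a)%R -> eGamma a \is a fin_num.
Proof.
move=> a0; rewrite ge0_fin_numE ?eGamma_ge0//.
(* [k] satisfies [1 / a <= 2^k] and controls the singularity at 0; [m] satisfies [a <= (m + 1) / 2]
   and controls the tail. *)
pose k := Num.bound a^-1%R; pose m := Num.bound (2 * a)%R.
have ka : (1 <= 2 ^+ k * a)%R.
  rewrite -ler_pdivrMr// mul1r (le_trans (ltW (archi_boundP _)))//.
    by rewrite invr_ge0 ltW.
  by rewrite -natrX ler_nat ltnW// ltn_expl.
have ma : (a <= m.+1%:R / 2)%R.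
  rewrite ler_pdivlMr// mulrC (le_trans (ltW (archi_boundP _)))//.
    by rewrite mulr_ge0// ltW.
  by rewrite ler_nat.
have mG b : measurable_fun setT (fun t : R => (t `^ (b - 1) * expR (- t))%:E).
  apply/measurable_EFinP; apply: measurable_funM; first exact: measurable_powR.
  by apply: measurableT_comp => //; exact: measurable_funN.
have mJ : measurable_fun setT
    (fun t : R => (t `^ (a - 1) * \1_`]-oo, 1%R] t)%:E).
  apply/measurable_EFinP; apply: measurable_funM; first exact: measurable_powR.
  exact: measurable_indic.
apply: (@le_lt_trans _ _ (\int[mu]_(t in `]0%R, +oo[)
    ((t `^ (a - 1) * \1_`]-oo, 1%R] t)%:E +
     (t `^ (m.+1%:R / 2 - 1) * expR (- t))%:E))).
  apply: ge0_le_integral => //.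
  - by move=> t _; rewrite lee_fin mulr_ge0 ?powR_ge0 ?expR_ge0.
  - exact: measurable_funTS (mG a).
  - by apply: measurable_funTS; exact: emeasurable_funD mJ (mG _).
  move=> t /=; rewrite in_itv/= andbT -EFinD lee_fin indicE mem_setE in_itv/= => t0.
  case: (leP t 1%R) => t1.
    rewrite mulr1 ler_wpDr ?mulr_ge0 ?powR_ge0 ?expR_ge0//.
    by rewrite ler_piMr ?powR_ge0// -expR0 ler_expR oppr_le0 ltW.
  rewrite mulr0 add0r ler_wpM2r ?expR_ge0//.
  by apply: ler_powR; [exact: ltW|rewrite lerD2r].
rewrite ge0_integralD//.
- rewrite lte_add_pinfty ?(integral_powR01_lty ka)//.
  by rewrite -ge0_fin_numE ?eGamma_ge0// eGamma_half_fin.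
- by move=> t _; rewrite lee_fin mulr_ge0// powR_ge0.
- exact: measurable_funTS mJ.
- by move=> t _; rewrite lee_fin mulr_ge0 ?powR_ge0 ?expR_ge0.
- exact: measurable_funTS (mG _).
Qed.

Lemma EFin_Gamma (a : R) : (0 < a)%R -> (Gamma a)%:E = eGamma a.
Proof. by move=> a0; rewrite /Gamma /Rintegral fineK//; exact: eGamma_fin. Qed.

End gamma_finite.

(** * Boxes as an intersection-stable generator of the measurable sets of tuples *)

Section boxes.
Context {R : realType} (n : nat).

Definition box (B : 'I_n -> set R) : set (n.-tuple R) :=
  [set x | forall i, B i (tnth x i)].

Definition boxes : set (set (n.-tuple R)) :=
  [set box B | B in [set B | forall i, measurable (B i)]].

Lemma measurable_box B : (forall i, measurable (B i)) -> measurable (box B).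
Proof.
move=> mB.
rewrite (_ : box B = \bigcap_(i in [set: 'I_n]) ((@tnth n R)^~ i @^-1` B i)).
  apply: fin_bigcap_measurable => // i _; rewrite -[X in measurable X]setTI.
  exact: (@measurable_tnth _ R n i).
by apply/seteqP; split => x /= Bx i => [_|]; exact: Bx.
Qed.

Lemma measurable_tuple_boxes : measurable = <<s boxes >>.
Proof.
apply/seteqP; split; last first.
  apply: smallest_sub; first exact: sigma_algebra_measurable.
  by move=> _ [B mB <-]; exact: measurable_box.
apply: smallest_sub; first exact: smallest_sigma_algebra.
apply: (big_ind (fun S => S `<=` <<s boxes >>)) => //.
  by move=> S1 S2 h1 h2 A [/h1|/h2].
move=> i _ _ [B mB <-]; apply: sub_sigma_algebra.
(* A generator, the preimage of [B] under coordinate [i], is the box whose other sides are the whole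
   line. *)
exists (fun j => if j == i then B else setT); first by move=> j; case: ifP.
apply/seteqP; split => x /=.
  by move=> /(_ i); rewrite eqxx.
by move=> [_ Bx] j; case: ifP => // /eqP ->.
Qed.

Lemma setI_closed_boxes : setI_closed boxes.
Proof.
move=> _ _ [B mB <-] [C mC <-]; exists (fun i => B i `&` C i).
  by move=> i; exact: measurableI.
apply/seteqP; split => x /=.
  by move=> BCx; split => i; have [] := BCx i.
by move=> [Bx Cx] i.
Qed.

End boxes.

(** * The joint law of independent variables with a common density *)

Section joint_law.
Local Open Scope ereal_scope.
Context {R : realType} (disp : measure_display) (T : measurableType disp)
  (P : probability T R) (n : nat) (X : 'I_n -> {RV P >-> R}) (p : R -> R).
Hypotheses (mp : measurable_fun setT p) (p0 : forall x, (0 <= p x)%R)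
  (indX : mutually_independent X) (denX : forall i, has_density (X i) p).

Let phi (w : T) : n.-tuple R := [tuple X i w | i < n].
Let pn (x : n.-tuple R) : R := (\prod_(i < n) p (tnth x i))%R.

Let mphi : measurable_fun setT phi.
Proof.
apply/measurable_fun_tnthP => i.
rewrite (_ : _ \o _ = X i); first exact: measurable_funP.
by apply/funext => w /=; rewrite tnth_mktuple.
Qed.

Let mpn : measurable_fun setT pn.
Proof.
apply: measurable_prod => i _.
exact: measurableT_comp mp (@measurable_tnth _ R n i).
Qed.

Let pn0 x : (0 <= pn x)%R. Proof. by rewrite prodr_ge0. Qed.

Let m01 (w : T) : (0 <= (cst 1 : T -> R) w)%R. Proof. by []. Qed.

(** [m1] is the law of the random vector, as an image with density 1; [m2] is the measure with the
    product density, as an image under the identity. *)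
Let m1 : {measure set (n.-tuple R) -> \bar R} :=
  pushforward_density P mphi (@measurable_cst _ _ _ _ setT (1%R : R)) m01.
Let m2 : {measure set (n.-tuple R) -> \bar R} :=
  pushforward_density (@lebesgue_tuple R n) (@measurable_id _ _ setT) mpn pn0.

Let m1E A : measurable A -> m1 A = P (phi @^-1` A).
Proof.
move=> mA; rewrite -[LHS]/(\int[P]_(x in phi @^-1` A) _).
rewrite (eq_integral (cst 1))// integral_cst ?mul1e//.
by rewrite -[X in measurable X]setTI; exact: mphi.
Qed.

Let m1_box B : (forall i, measurable (B i)) ->
  m1 (box B) = \prod_(i < n) \int[lebesgue_measure]_(x in B i) (p x)%:E.
Proof.
move=> mB; rewrite m1E; last exact: measurable_box.
(* Independence is used for the full index set. *)
have -> : phi @^-1` box B =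
    \bigcap_(i in [set i | i \in [set: 'I_n]%SET]) X i @^-1` B i.
  apply/seteqP; split => w /=.
    by move=> Bw i _; have := Bw i; rewrite tnth_mktuple.
  by move=> Bw i; rewrite tnth_mktuple; apply: Bw; rewrite /= finset.in_setT.
rewrite indX//; apply: eq_big => i; first by rewrite finset.in_setT.
by move=> _; exact: (denX i (mB i)).
Qed.

Let m2_box B : (forall i, measurable (B i)) ->
  m2 (box B) = \prod_(i < n) \int[lebesgue_measure]_(x in B i) (p x)%:E.
Proof.
move=> mB; rewrite -[LHS]/(\int[@lebesgue_tuple R n]_(x in box B) (pn x)%:E).
rewrite integral_mkcond.
transitivity (\int[@lebesgue_tuple R n]_x
    (\prod_(i < n) (p (tnth x i) * \1_(B i) (tnth x i)))%:E).
  apply: eq_integral => x _; rewrite /patch big_split/= -/(pn x).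
  case: ifPn => [/set_mem Bx|nBx].
    rewrite big1 ?mulr1// => i _.
    by rewrite indicE mem_set//; exact: Bx.
  have [i nBi] : exists i, ~ B i (tnth x i).
    apply/existsNP => Bx; move/negP: nBx; apply; exact/mem_set.
  by rewrite (bigD1 i)//= indicE memNset// mul0r mulr0.
rewrite (@ge0_integral_tuple_prod R n (fun i x => p x * \1_(B i) x)%R).
- apply: eq_bigr => i _; rewrite [RHS]integral_mkcond.
  apply: eq_integral => x _; rewrite /patch indicE.
  by case: ifP => _; rewrite ?mulr1 ?mulr0.
- by move=> i; apply: measurable_funM => //; exact: measurable_indic.
- by move=> i x; rewrite mulr_ge0.
Qed.

(** [m1] and [m2] agree on boxes, and the whole space is a box of mass 1, so the two measures
    coincide and have the same integrals. *)
Lemma ge0_expectation_density (g : n.-tuple R -> \bar R) :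
  measurable_fun setT g -> (forall x, 0 <= g x) ->
  \int[P]_w g [tuple X i w | i < n] =
  \int[@lebesgue_tuple R n]_x (g x * (\prod_(i < n) p (tnth x i))%:E).
Proof.
move=> mg g0.
have m12 A : measurable A -> m1 A = m2 A.
  apply: (@measure_unique _ R _ (@boxes R n) (fun=> setT)).
  - exact: measurable_tuple_boxes.
  - exact: setI_closed_boxes.
  - by move=> _; exists (fun=> setT) => //; exact/seteqP.
  - by rewrite bigcup_const.
  - by move=> _ [B mB <-]; rewrite m1_box// m2_box.
  - by move=> _; rewrite m1E// preimage_setT probability_setT ltry.
transitivity (\int[m2]_x g x).
  rewrite (@ge0_integral_pushforward_density _ _ _ _ _ P phi (cst 1%R))//.
    by apply: eq_integral => w _; rewrite mule1.
  by move=> A mA; rewrite -m12.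
exact: (@ge0_integral_pushforward_density _ _ _ _ _ (@lebesgue_tuple R n) id pn).
Qed.

End joint_law.

(* With infinite terms: +oo - +oo = -oo, and a null k gives 0 on both sides. *)
Lemma ge0_muleBr (R : realType) (k : R) (a b : \bar R) : 0 <= k ->
  (0 <= a -> 0 <= b -> k%:E * (a - b) = k%:E * a - k%:E * b)%E.
Proof.
rewrite le_eqVlt => /predU1P[<- _ _|k0]; first by rewrite !mul0e sube0.
case: a => [a| |]//; case: b => [b| |]// a0 b0.
- by rewrite -EFinB -!EFinM -EFinB mulrBr.
- by rewrite /= gt0_muleNy ?gt0_muley ?lte_fin.
- by rewrite /= gt0_muley ?lte_fin.
- by rewrite /= gt0_muleNy ?gt0_muley ?lte_fin.
Qed.

Lemma homogeneous_max0 (R : realType) n (d : R) (f : n.-tuple R -> R) :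
  homogeneous d f -> homogeneous d (fun x => Num.max (f x) 0).
Proof.
by move=> hf l x l0; rewrite hf// maxr_pMr ?powR_ge0// mulr0.
Qed.

(** * The identity for nonnegative homogeneous functions *)

Section sphere_gauss.
Local Open Scope ereal_scope.
Context (R : realType) (n : nat) (d : R) (disp : measure_display)
  (T : measurableType disp) (P : probability T R) (X : 'I_n.+1 -> {RV P >-> R}).
Hypotheses (nd0 : (0 < n.+1%:R + d)%R) (indX : mutually_independent X)
  (denX : forall i, has_density (X i) (fun x => expR (- x ^+ 2) / Num.sqrt pi)%R).

Let sqrtpi_gt0 : (0 < Num.sqrt pi :> R)%R.
Proof. by rewrite sqrtr_gt0 pi_gt0. Qed.

(** Polar coordinates and the joint density turn both sides into multiples of the same Gaussian
    integral [B], possibly infinite; the area formula matches the constants. *)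
Lemma ge0_sphere_gauss (f : n.+1.-tuple R -> R) (s : R) :
  sphere_area n (unit_sphere n.+1) = s%:E -> (0 < s)%R ->
  measurable_fun setT f -> (forall x, 0 <= f x)%R -> homogeneous d f ->
  (Gamma ((n.+1%:R + d) / 2) / s)%:E *
    \int[sphere_area n]_(x in unit_sphere n.+1) (f x)%:E =
  (Gamma (n.+1%:R / 2))%:E * \int[P]_w (f [tuple X i w | i < n.+1])%:E.
Proof.
move=> sE s0 mf f0 hf.
have mp : measurable_fun setT (fun x : R => expR (- x ^+ 2) / Num.sqrt pi)%R.
  apply: measurable_funM => //; apply: measurableT_comp => //.
  by apply: measurable_funN; exact: measurable_funX.
have p0 (x : R) : (0 <= expR (- x ^+ 2) / Num.sqrt pi)%R.
  by rewrite divr_ge0 ?expR_ge0 ?ltW.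
have mf' : measurable_fun setT (EFin \o f) by exact/measurable_EFinP.
have mB : measurable_fun setT (fun x => (f x * expR (- sqnorm x))%:E).
  apply/measurable_EFinP; apply: measurable_funM => //.
  apply: measurableT_comp => //; apply: measurable_funN.
  exact: measurable_sqnorm.
have B0 x : setT x -> 0 <= (f x * expR (- sqnorm x))%:E.
  by move=> _; rewrite lee_fin mulr_ge0 ?expR_ge0.
set A := \int[sphere_area n]_(x in _) _.
pose B := \int[@lebesgue_tuple R n.+1]_x (f x * expR (- sqnorm x))%:E.
have HA : (Gamma ((n.+1%:R + d) / 2))%:E * A = 2%:E * B.
  have a0 : (0 < (n.+1%:R + d) / 2)%R by rewrite divr_gt0.
  rewrite (EFin_Gamma a0) /A (polar_coordinates mf f0 hf).
  rewrite -(ge0_integralZl_EFin _ measurableT B0 mB)//.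
have HE : \int[P]_w (f [tuple X i w | i < n.+1])%:E =
    ((Num.sqrt pi ^+ n.+1)^-1)%:E * B.
  rewrite (ge0_expectation_density mp p0 indX denX mf')//=.
  rewrite -(ge0_integralZl_EFin _ measurableT B0 mB); last first.
    by rewrite invr_ge0 exprn_ge0 ?ltW.
  apply: eq_integral => x _; rewrite -!EFinM; congr EFin.
  rewrite big_split/= -expR_sum sumrN prodr_const card_ord exprVn.
  by rewrite -/(sqnorm x); ring.
have HG : (Gamma (n.+1%:R / 2) * s = 2 * Num.sqrt pi ^+ n.+1)%R.
  have a0 : (0 < n.+1%:R / 2 :> R)%R by rewrite divr_gt0.
  by have := @eGamma_sphere_area R n; rewrite sE -(EFin_Gamma a0) -EFinM => -[].
(* Only the coefficients of [B] remain to be compared; multiplying by the area [s] brings in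
   [HG]. *)
rewrite HE mulrC EFinM -muleA HA !muleA -!EFinM.
congr (_%:E * _); apply: (mulIf (lt0r_neq0 s0)).
rewrite mulrAC mulVf ?lt0r_neq0// mul1r mulrAC HG.
by rewrite mulfK// lt0r_neq0// exprn_gt0.
Qed.

End sphere_gauss.

(** The equality is in the extended reals and so covers a non-integrable [f]; [0 < n.+1 + d] is the
    range where the integral in the left Gamma factor converges. *)
Theorem theorem3 (R : realType) (n : nat) (d : R) (f : n.+1.-tuple R -> R)
    (disp : measure_display) (T : measurableType disp) (P : probability T R)
    (X : 'I_n.+1 -> {RV P >-> R}) :
  measurable_fun [set: n.+1.-tuple R] f ->
  homogeneous d f ->
  0 < n.+1%:R + d ->
  mutually_independent X ->
  (forall i, has_density (X i) (fun x => expR (- x ^+ 2) / Num.sqrt pi)) ->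
  ((Gamma ((n.+1%:R + d) / 2))%:E *
     ((sphere_area n (unit_sphere n.+1))^-1 *
      \int[sphere_area n]_(x in unit_sphere n.+1) (f x)%:E) =
   (Gamma (n.+1%:R / 2))%:E *
     'E_P[fun w => f [tuple X i w | i < n.+1]])%E.
Proof.
move=> mf hf nd0 indX denX.
have pi0 : 0 < 2 * Num.sqrt pi ^+ n.+1 :> R.
  by rewrite mulr_gt0// exprn_gt0// sqrtr_gt0 pi_gt0.
have [_ sfin] := mule_fin_gt0 (eGamma_ge0 _)
  (measure_ge0 (sphere_area n) (unit_sphere n.+1)) pi0 (@eGamma_sphere_area R n).
pose s : R := fine (sphere_area n (unit_sphere n.+1)).
have sE : sphere_area n (unit_sphere n.+1) = s%:E by rewrite /s fineK.
have s0 : 0 < s.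
  rewrite lt0r -lee_fin -sE measure_ge0 andbT; apply/eqP => s0.
  have := @eGamma_sphere_area R n; rewrite sE s0 mule0 => -[] /esym/eqP.
  by rewrite gt_eqF.
have Gamma_ge0 b : 0 < b -> 0 <= Gamma b :> R.
  by move=> b0; rewrite -lee_fin EFin_Gamma// eGamma_ge0.
have k0 : 0 <= Gamma ((n.+1%:R + d) / 2) / s.
  by rewrite divr_ge0 ?Gamma_ge0 ?ltW// divr_gt0.
have mpos : measurable_fun setT (fun x => Num.max (f x) 0).
  exact: measurable_maxr.
have mneg : measurable_fun setT (fun x => Num.max (- f x) 0).
  by apply: measurable_maxr => //; exact: measurable_funN.
(* The negative part of [f] is the positive part of [- f], hence homogeneous as well. *)
have hN : homogeneous d (fun x => - f x).
  by move=> l x l0; rewrite hf// mulrN.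
have max0 (r : R) : 0 <= Num.max r 0 by rewrite le_max lexx orbT.
have Hpos := ge0_sphere_gauss nd0 indX denX sE s0 mpos (fun x => max0 _)
  (homogeneous_max0 hf).
have Hneg := ge0_sphere_gauss nd0 indX denX sE s0 mneg (fun x => max0 _)
  (homogeneous_max0 hN).
rewrite sE inver (gt_eqF s0) muleA -EFinM.
(* The inner map [u] lets one splitting serve both the sphere, with [u = id], and the expectation,
   with [u] the random vector. *)
have fE dT (T' : measurableType dT) (m : {measure set T' -> \bar R}) D u :
    (\int[m]_(x in D) (f (u x))%:E =
     \int[m]_(x in D) (Num.max (f (u x)) 0)%:E -
     \int[m]_(x in D) (Num.max (- f (u x)) 0)%:E)%E.
  rewrite integralE; congr (_ - _)%E; apply: eq_integral => x _.
    by rewrite funeposE -EFin_max.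
  by rewrite funenegE -EFinN -EFin_max.
rewrite unlock (fE _ _ (sphere_area n) _ id) (fE _ _ P).
have g0 : 0 <= Gamma (n.+1%:R / 2) :> R by rewrite Gamma_ge0// divr_gt0.
rewrite (ge0_muleBr k0); last 2 first.
- by apply: integral_ge0 => x _; rewrite lee_fin.
- by apply: integral_ge0 => x _; rewrite lee_fin.
rewrite (ge0_muleBr g0); last 2 first.
- by apply: integral_ge0 => x _; rewrite lee_fin.
- by apply: integral_ge0 => x _; rewrite lee_fin.
by rewrite Hpos Hneg.
Qed.
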